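(* Let $(\mathfrak g,[-,-],R)$ be a Rota-Baxter Lie algebra of weight $\lambda$ over $\mathbf k$. If $R$ is idempotent ($R^2=R$), then $$(1+\lambda)R([R(x),y])=(1+\lambda)\big([R(x),R(y)]-\lambda R([x,y])\big)=0,\qquad x,y\in\mathfrak g.$$ In particular, when $\lambda\neq-1$, such an idempotent Rota-Baxter operator $R$ is a Lie algebra homomorphism from $(\mathfrak g,[-,-]_\lambda)$ to $(\mathfrak g,[-,-])$, where $[x,y]_\lambda:=\lambda[x,y]$, with $R(\mathfrak g)$ abelian and $\ker R$ stable under the adjoint action of $R(\mathfrak g)$.
   Context: Convention: $\mathbf k$ is an algebraically closed field of prime characteristic $p$; everything is over $\mathbf k$. A Rota-Baxter Lie algebra of weight $\lambda\in\mathbf k$ is a Lie algebra $(\mathfrak g,[-,-])$ with a linear map $R:\mathfrak g\to\mathfrak g$ such that $[R(x),R(y)]=R([R(x),y])+R([x,R(y)])+\lambda R([x,y])$ for all $x,y\in\mathfrak g$. *)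

(* Defs.v *)
From HB Require Import structures.
From mathcomp Require Import all_boot all_order all_algebra.

Set Implicit Arguments.
Unset Strict Implicit.
Unset Printing Implicit Defensive.

Import GRing.Theory.
Local Open Scope ring_scope.

(* Lie brackets are predicates on operations rather than a structure on the
   carrier, because two brackets on the same space are compared below.
   The alternating law, not just antisymmetry, is required: this matters in
   characteristic 2. *)
Record lie_bracket (k : fieldType) (g : lmodType k) (br : g -> g -> g) : Prop :=
  LieBracket {
    lie_linearl : forall y, linear (fun x => br x y);
    lie_linearr : forall x, linear (br x);
    lie_alternating : forall x, br x x = 0;
    lie_jacobi : forall x y z,
      br x (br y z) + br y (br z x) + br z (br x y) = 0
  }.

Definition rota_baxter (k : fieldType) (g : lmodType k) (br : g -> g -> g)
    (lam : k) (R : g -> g) : Prop :=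
  forall x y,
    br (R x) (R y) = R (br (R x) y) + R (br x (R y)) + lam *: R (br x y).

Record rota_baxter_lie_algebra (k : fieldType) (g : lmodType k)
    (br : g -> g -> g) (lam : k) (R : g -> g) : Prop :=
  RotaBaxterLieAlgebra {
    rbl_lie : lie_bracket br;
    rbl_linear : linear R;
    rbl_rota_baxter : rota_baxter br lam R
  }.

Definition scaled_bracket (k : fieldType) (g : lmodType k) (lam : k)
    (br : g -> g -> g) : g -> g -> g :=
  fun x y => lam *: br x y.

(* Homomorphism of Lie algebras (g, br) -> (h, br'); both brackets are required
   to be Lie brackets. *)
Record lie_hom (k : fieldType) (g h : lmodType k) (br : g -> g -> g)
    (br' : h -> h -> h) (f : g -> h) : Prop :=
  LieHom {
    lie_hom_dom : lie_bracket br;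
    lie_hom_cod : lie_bracket br';
    lie_hom_linear : linear f;
    lie_hom_bracket : forall x y, f (br x y) = br' (f x) (f y)
  }.

Definition im (g h : Type) (f : g -> h) : h -> Prop :=
  fun a => exists x, f x = a.

Definition ker (g : Type) (h : zmodType) (f : g -> h) : g -> Prop :=
  fun x => f x = 0.

Record lie_subalgebra (k : fieldType) (g : lmodType k) (br : g -> g -> g)
    (S : g -> Prop) : Prop :=
  LieSubalgebra {
    lie_sub0 : S 0;
    lie_sub_linear : forall (c : k) a b, S a -> S b -> S (c *: a + b);
    lie_sub_bracket : forall a b, S a -> S b -> S (br a b)
  }.

Definition abelian_subalgebra (k : fieldType) (g : lmodType k)
    (br : g -> g -> g) (S : g -> Prop) : Prop :=
  lie_subalgebra br S /\ (forall a b, S a -> S b -> br a b = 0).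

Definition ad (g : Type) (br : g -> g -> g) (a : g) : g -> g := br a.

Definition ad_stable (g : Type) (br : g -> g -> g) (S K : g -> Prop) : Prop :=
  forall a v, S a -> K v -> K (ad br a v).

(* Main.v *)
Require Import Defs.
From HB Require Import structures.
From mathcomp Require Import all_boot all_order all_algebra.

Set Implicit Arguments.
Unset Strict Implicit.
Unset Printing Implicit Defensive.

Import GRing.Theory.
Local Open Scope ring_scope.

(* Since R y is fixed by R, the Rota-Baxter identity at (x, R y) reads
   [R x, R y] = R [R x, R y] + (1 + lam) R [x, R y].  Applying R cancels the
   first two terms and leaves (1 + lam) R [x, R y] = 0; everything else follows
   from this and its mirror image at (R x, y). *)

(** Supplies the source structure that [lie_hom] demands, for every [lam], zero included. Each
    Jacobi term picks up the factor [lam] twice, once per nested bracket. *)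
Lemma scaled_bracket_lie (k : fieldType) (g : lmodType k) (br : g -> g -> g)
    (lam : k) : lie_bracket br -> lie_bracket (scaled_bracket lam br).
Proof.
move=> [linl linr alt jac]; rewrite /scaled_bracket; split.
- by move=> y a u v; rewrite /= linl scalerDr !scalerA mulrC.
- by move=> x a u v; rewrite /= linr scalerDr !scalerA mulrC.
- by move=> x; rewrite alt scaler0.
- move=> x y z; rewrite !(scalable_linear (linr _)) -!scalerDr jac.
  by rewrite !scaler0.
Qed.

Section IdempotentRotaBaxter.

Context (k : fieldType) (g : lmodType k) (br : g -> g -> g) (lam : k).
Context (R : g -> g) (linR : linear R) (rbR : rota_baxter br lam R).
Context (idemR : forall x, R (R x) = R x).

Let RD : {morph R : x y / x + y}.
Proof. by move=> x y; have := linR 1 x y; rewrite !scale1r. Qed.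

Let RZ : scalable R. Proof. exact: scalable_linear linR. Qed.

Lemma idem_rota_baxter_fixr x y :
  br (R x) (R y) = R (br (R x) (R y)) + (1 + lam) *: R (br x (R y)).
Proof. by have := rbR x (R y); rewrite idemR scalerDl scale1r addrA. Qed.

Lemma idem_rota_baxter_fixl x y :
  br (R x) (R y) = R (br (R x) (R y)) + (1 + lam) *: R (br (R x) y).
Proof.
have := rbR (R x) y; rewrite idemR [R (br (R x) y) + _]addrC.
by rewrite scalerDl scale1r addrA.
Qed.

Lemma idem_rota_baxter_kerr x y : (1 + lam) *: R (br x (R y)) = 0.
Proof.
have /esym/eqP := congr1 R (idem_rota_baxter_fixr x y).
by rewrite RD RZ !idemR -subr_eq0 addrC addKr => /eqP.
Qed.

Lemma idem_rota_baxter_kerl x y : (1 + lam) *: R (br (R x) y) = 0.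
Proof.
have /esym/eqP := congr1 R (idem_rota_baxter_fixl x y).
by rewrite RD RZ !idemR -subr_eq0 addrC addKr => /eqP.
Qed.

(** By the Rota-Baxter identity the difference is [R (br (R x) y) + R (br x (R y))], and [1 + lam]
    kills each summand. *)
Lemma idem_rota_baxter_hom x y :
  (1 + lam) *: (br (R x) (R y) - lam *: R (br x y)) = 0.
Proof.
by rewrite rbR addrK scalerDr idem_rota_baxter_kerl idem_rota_baxter_kerr addr0.
Qed.

End IdempotentRotaBaxter.

Theorem proposition4p3 (k : closedFieldType) (p : nat) (hp : p \in [pchar k])
    (g : lmodType k) (br : g -> g -> g) (lam : k) (R : g -> g)
    (hR : rota_baxter_lie_algebra br lam R)
    (idemR : forall x, R (R x) = R x) :
  (forall x y,
     (1 + lam) *: R (br (R x) y)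
       = (1 + lam) *: (br (R x) (R y) - lam *: R (br x y))
     /\ (1 + lam) *: (br (R x) (R y) - lam *: R (br x y)) = 0)
  /\ (lam != -1 ->
      [/\ lie_hom (scaled_bracket lam br) br R,
          abelian_subalgebra br (im R)
        & ad_stable br (im R) (ker R)]).
Proof.
case: hR => lieR linR rbR.
have kerl := idem_rota_baxter_kerl linR rbR idemR.
have hom := idem_rota_baxter_hom linR rbR idemR.
split=> [x y|lamN1]; first by rewrite kerl hom.
have lamU : 1 + lam != 0 by rewrite addrC addr_eq0.
(* This is where [lam != -1] enters: [1 + lam] is a nonzero scalar of a field, so it can be
   cancelled. *)
have cancel (v : g) : (1 + lam) *: v = 0 -> v = 0.
  by move/eqP; rewrite scaler_eq0 (negPf lamU) => /eqP.
have Rl x y : R (br (R x) y) = 0 by exact/cancel/kerl.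
(* In [br (R x) (R y) = R (br (R x) (R y)) + (1 + lam) *: R (br (R x) y)], the last term is zero by
   [kerl] and the first is [Rl] at [(x, R y)]. *)
have Rab x y : br (R x) (R y) = 0.
  by rewrite (idem_rota_baxter_fixl rbR idemR) kerl Rl addr0.
have RZ : scalable R := scalable_linear linR.
have R0 : R 0 = 0.
  by have := RZ 0 0; rewrite !scale0r.
split.
- split=> // [|x y]; first exact: scaled_bracket_lie.
  rewrite /scaled_bracket RZ.
  by apply/esym/eqP; rewrite -subr_eq0; apply/eqP/cancel/hom.
- split; last by move=> _ _ [x <-] [y <-].
  split.
  + by exists 0.
  + by move=> c _ _ [x <-] [y <-]; exists (c *: x + y); rewrite linR.
  (* The bracket vanishes on the image, so closure only asks for a preimage of [0]. *)
  + by move=> _ _ [x <-] [y <-]; rewrite Rab; exists 0.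
(* [Rl] puts the bracket of the image with all of [g] inside the kernel. *)
- by move=> _ v [x <-] _; exact: Rl.
Qed.
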